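(* Let $\Gamma \subset \operatorname{Aut}(\mathbb{C}^n)$ be a discrete group of affine automorphisms of $\mathbb{C}^n$ acting freely and properly discontinuously on $\mathbb{C}^n$. Then the quotient manifold $M = \mathbb{C}^n/\Gamma$ is elliptic.
   Context: $\operatorname{Aut}(\mathbb{C}^n)$ is the group of holomorphic automorphisms of $\mathbb{C}^n$. An affine automorphism of $\mathbb{C}^n$ is a map $z \mapsto Az + b$ with $A \in \operatorname{GL}(n,\mathbb{C})$ and $b \in \mathbb{C}^n$. Since $\Gamma$ acts freely and properly discontinuously, $\mathbb{C}^n/\Gamma$ is a complex $n$-manifold and the quotient map $\mathbb{C}^n \to \mathbb{C}^n/\Gamma$ is a holomorphic covering map. A complex manifold $M$ is elliptic if there exist a holomorphic vector bundle $E \to M$ and a holomorphic map $s : E \to M$ (called a dominating spray) such that, for all $x \in M$, $s(0_x) = x$ and the restriction $s|_{E_x} : E_x \to M$ to the fibre $E_x$ is a submersion at $0_x$, where $0_x$ is the zero vector of $E_x$. *)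

(* Defs.v *)
From HB Require Import structures.
From mathcomp Require Import all_boot all_order all_algebra.
From mathcomp Require Import complex.
From mathcomp Require Import all_classical all_reals all_analysis.

Set Implicit Arguments.
Unset Strict Implicit.
Unset Printing Implicit Defensive.

Import Order.TTheory GRing.Theory Num.Theory.
Import numFieldNormedType.Exports.

Local Open Scope classical_set_scope.
Local Open Scope ring_scope.

(* The field of complex numbers.  It is given as a [numClosedFieldType] so
   that it, and the column vectors over it, receive the norm topology of
   numeric fields; [R[i]] alone carries no topology. *)
Definition Cplx (R : realType) : numClosedFieldType := R[i]%C.

Lemma hausdorffX (S T : topologicalType) :
  hausdorff_space S -> hausdorff_space T -> hausdorff_space (S * T)%type.
Proof.
move=> hS hT [s t] [s' t'] cl; congr pair.
  apply: hS => A B sA s'B.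
  have [|| [x y] [[/= Ax _] [/= Bx _]]] := cl (A `*` setT) (B `*` setT).
  - by exists (A, setT) => //; split => //; exact: filterT.
  - by exists (B, setT) => //; split => //; exact: filterT.
  by exists x.
apply: hT => A B tA t'B.
have [|| [x y] [[/= _ Ax] [/= _ Bx]]] := cl (setT `*` A) (setT `*` B).
- by exists (setT, A) => //; split => //; exact: filterT.
- by exists (setT, B) => //; split => //; exact: filterT.
by exists y.
Qed.

Lemma openX (S T : topologicalType) (A : set S) (B : set T) :
  open A -> open B -> open (A `*` B).
Proof.
rewrite !openE => oA oB [x y] [/= Ax By].
by exists (A, B) => //; split; [exact: oA | exact: oB].
Qed.

Lemma second_countableX (S T : topologicalType) :
  @second_countable S -> @second_countable T ->
  @second_countable (S * T)%type.
Proof.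
move=> [A cA [oA bA]] [B cB [oB bB]].
exists [set P.1 `*` P.2 | P in A `*` B].
  apply: card_le_trans (card_image_le _ _) _; exact: countableX.
split; first by move=> _ [[a b] [/= Aa Bb] <-]; apply: openX; [exact: oA|exact: oB].
move=> [x y] W [[U V] [/= xU yV] UVW].
have [a [Aa ax] aU] := bA _ _ xU; have [b [Bb bby] bV] := bB _ _ yV.
exists (a `*` b); first by split => //; exists (a, b).
by move=> [u v] [/= /aU Uu /bV Vv]; apply: UVW.
Qed.

Lemma filter_finite_bigcap (T : Type) (I : choiceType) (F : set_system T)
    (D : set I) (f : I -> set T) :
  Filter F -> finite_set D -> (forall i, F (f i)) -> F (\bigcap_(i in D) f i).
Proof. by move=> FF /finite_fsetP[S ->] Ff; exact: filter_bigI. Qed.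

Section ComplexManifolds.

Variable R : realType.
Local Notation C := (Cplx R).

(* [differentiable] over the base field [C] is complex Frechet
   differentiability; on an open set this is holomorphy. *)
Definition entire (V W : normedModType C) (f : V -> W) : Prop :=
  forall z, differentiable f z.

Record chart (T : topologicalType) (V : normedModType C) := Chart {
  chart_dom : set T;
  chart_img : set V;
  chart_map :> T -> V;
  chart_inv : V -> T;
  chart_dom_open : open chart_dom;
  chart_img_open : open chart_img;
  chart_map_img : forall x, chart_dom x -> chart_img (chart_map x);
  chart_inv_dom : forall v, chart_img v -> chart_dom (chart_inv v);
  chart_mapK : forall x, chart_dom x -> chart_inv (chart_map x) = x;
  chart_invK : forall v, chart_img v -> chart_map (chart_inv v) = v;
  chart_map_continuous : forall x, chart_dom x -> {for x, continuous chart_map};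
  chart_inv_continuous : forall v, chart_img v -> {for v, continuous chart_inv}
}.

(* Complex manifolds modelled on [V]; [V] is [C^n] or a product [C^n * C^r]
   wherever this is used. The atlas is not required to be maximal. *)
Record complexManifold (V : normedModType C) := ComplexManifold {
  manifold_space :> topologicalType;
  atlas : set (chart manifold_space V);
  manifold_hausdorff : hausdorff_space manifold_space;
  manifold_second_countable : @second_countable manifold_space;
  atlas_cover : forall x, exists2 c, atlas c & chart_dom c x;
  atlas_compatible : forall c d, atlas c -> atlas d ->
    forall x, chart_dom c x -> chart_dom d x ->
      differentiable (d \o chart_inv c) (c x)
}.

Section Maps.
Context {V W : normedModType C} {M : complexManifold V} {N : complexManifold W}.

Definition cdifferentiable_at (f : M -> N) (x : M) : Prop :=
  {for x, continuous f} /\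
  forall c d, atlas c -> atlas d -> chart_dom c x -> chart_dom d (f x) ->
    differentiable (d \o f \o chart_inv c) (c x).

(* Meant for open [U]. *)
Definition holomorphic_on (U : set M) (f : M -> N) : Prop :=
  forall x, U x -> cdifferentiable_at f x.

Definition holomorphic (f : M -> N) : Prop := holomorphic_on setT f.

Definition submersion_at (f : M -> N) (x : M) : Prop :=
  cdifferentiable_at f x /\
  forall c d, atlas c -> atlas d -> chart_dom c x -> chart_dom d (f x) ->
    forall w : W, exists v : V, 'd (d \o f \o chart_inv c) (c x) v = w.

End Maps.

Lemma near_eq_differentiable (V W : normedModType C) (f g : V -> W) (x : V) :
  (\forall y \near x, f y = g y) -> differentiable f x -> differentiable g x.
Proof.
move=> fg df; have [dfc /eqaddoP fE] := (diff_locallyP x f).1 df.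
have fgx : f x = g x := nbhs_singleton fg.
have gE : g \o shift x = cst (g x) + 'd f x +o_ 0 id.
  apply/eqaddoP => e e0.
  have fg0 : \forall y \near 0, f (y + x) = g (y + x).
    by move: fg; rewrite (near_shift 0 x); apply: filterS => y /=; rewrite subr0.
  apply: filterS2 fg0 (fE e e0) => y /= E.
  by rewrite !fctE /= E fgx.
pose P (h : V -> W) := continuous h /\ g \o shift x = cst (g x) + h +o_ 0 id.
have Pf : P ('d f x) by split.
have E : 'd g x = 'd f x :> (V -> W) := diff_unique dfc gE.
apply/diff_locallyP; exact: (eq_ind_r P Pf E).
Qed.

Lemma cplx_inv_lt (e : C) : 0 < e -> exists n : nat, n.+1%:R^-1 < e.
Proof.
case: e => a b; rewrite ltcE /= => /andP[/eqP b0 a0]; subst b.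
have [N _ /(_ N (leqnn N))] := near_infty_natSinv_lt (PosNum a0).
rewrite /= => NA; exists N.
have -> : (N.+1%:R^-1 : C) = (N.+1%:R^-1)%:C%C :> R[i]%C by rewrite rmorphV ?unitfE ?pnatr_eq0 //= rmorph_nat.
by rewrite ltcE /= eqxx.
Qed.

Lemma dense_second_countable (V : normedModType C) (D : set V) :
  countable D ->
  (forall v (e : C), 0 < e -> exists2 d, D d & `|v - d| < e) ->
  @second_countable V.
Proof.
move=> cD dD; exists [set ball p.1 (p.2.+1%:R^-1 : C) | p in D `*` [set: nat]].
  apply: card_le_trans (card_image_le _ _) _; exact: countableX.
split; first by move=> _ [[d n] _ <-] /=; exact: ball_open.
move=> x U /nbhs_ballP [e /= e0 eU].
have [n ne] := @cplx_inv_lt (e / 2) (divr_gt0 e0 (ltr0Sn _ 1)).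
have n0 : 0 < n.+1%:R^-1 :> C by rewrite invr_gt0.
have [d Dd xd] := dD x _ n0.
exists (ball d (n.+1%:R^-1 : C)).
  by split; [exists (d, n) | rewrite -ball_normE /= distrC].
move=> y; rewrite -ball_normE /= => dy; apply: eU; rewrite -ball_normE /=.
rewrite -(subrKA d) (le_lt_trans (ler_normD _ _)) // [e]splitr.
by apply: ltrD; apply: lt_trans ne.
Qed.
Definition mkC (a b : R) : C := (a +i* b)%C.

Lemma mkC_norm_le (a b : R) : `|mkC a b| <= mkC (`|a| + `|b|) 0.
Proof.
rewrite /mkC normc_def /= lecE /= eqxx /=.
have s0 : 0 <= `|a| + `|b| by rewrite addr_ge0.
rewrite -[leRHS]ger0_norm // -sqrtr_sqr ler_wsqrtr // sqrrD !real_normK ?num_real //.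
by rewrite addrAC lerDl mulrn_wge0 // mulr_ge0.
Qed.

Lemma mkC_near (m : nat) (v : 'cV[C]_m) (w : 'cV[C]_m) (e : R) : 0 < e ->
  (forall i, `|complex.Re (v i 0 - w i 0)| < e / 2 /\
             `|complex.Im (v i 0 - w i 0)| < e / 2) ->
  `|v - w| < mkC e 0.
Proof.
move=> e0 H.
have e0' : 0 < mkC e 0 by rewrite ltcE /= eqxx.
have : ball w (mkC e 0) v.
  split=> // i j; rewrite ord1 -ball_normE /= distrC.
  have [Ha Hb] := H i.
  have -> : v i 0 - w i 0 = mkC (complex.Re (v i 0 - w i 0)) (complex.Im (v i 0 - w i 0)).
    by case: (v i 0 - w i 0).
  apply: le_lt_trans (mkC_norm_le _ _) _.
  by rewrite ltcE /= eqxx /= [e]splitr ltrD.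
by rewrite -ball_normE /= distrC.
Qed.

Lemma cV_second_countable (m : nat) : @second_countable 'cV[C]_m.
Proof.
pose q (u : 'cV[rat * rat]_m) : 'cV[C]_m :=
  \col_i mkC (ratr (u i 0).1) (ratr (u i 0).2).
apply: (@dense_second_countable _ (range q)).
  by apply: card_le_trans (card_image_le _ _) _; exact: countableP.
move=> v [e b]; rewrite ltcE /= => /andP[/eqP b0 e0]; subst b.
have dR (a : R) : exists r : rat, `|a - ratr r| < e / 2.
  have ne : ball a (e / 2) !=set0 by exists a; apply: ballxx; rewrite divr_gt0.
  have [y [/= H [r _ rE]]] := @dense_rat R _ ne (ball_open _ _).
  by exists r; rewrite rE.
have [f fP] : {f : R -> rat & forall a, `|a - ratr (f a)| < e / 2}.
  by exists (fun a => projT1 (cid (dR a))) => a; case: cid.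
exists (q (\col_i (f (complex.Re (v i 0)), f (complex.Im (v i 0))))); first by eexists.
apply: mkC_near => // i; rewrite !mxE /=.
by case: (v i 0) => a b /=; split; exact: fP.
Qed.

Lemma cV_locally_compact (m : nat) (x : 'cV[C]_m) :
  exists2 K : set 'cV[C]_m, nbhs x K & compact K.
Proof.
pose F (v : 'rV[R]_(m + m)) : 'cV[C]_m :=
  \col_i mkC (v 0 (lshift m i)) (v 0 (rshift m i)).
have Fc : continuous F.
  move=> v U /nbhs_ballP [[e b] /=]; rewrite ltcE /= => /andP[/eqP b0 e0] eU; subst b.
  apply/nbhs_ballP; exists (e / 2) => /=; first by rewrite divr_gt0.
  move=> w [_ vw]; apply: eU; rewrite -ball_normE /=.
  apply: mkC_near => // i; rewrite !mxE /=; split.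
    by have := vw 0 (lshift m i); rewrite -ball_normE.
  by have := vw 0 (rshift m i); rewrite -ball_normE.
pose c (j : 'I_(m + m)) : R :=
  match fintype.split j with inl i => complex.Re (x i 0) | inr i => complex.Im (x i 0) end.
pose A (j : 'I_(m + m)) : set R := `[c j - 1, c j + 1]%classic.
exists (F @` [set v : 'rV[R]_(m + m) | forall j, A j (v 0 j)]); last first.
  apply: continuous_compact; first exact: continuous_subspaceT.
  by apply: rV_compact => j; exact: segment_compact.
apply/nbhs_ballP; exists 1 => //= y [_ xy].
exists (row_mx (\row_i complex.Re (y i 0)) (\row_i complex.Im (y i 0))); last first.
  apply/colP => i; rewrite mxE row_mxEl row_mxEr !mxE /mkC.
  by case: (y i 0).
have Hb i : `|x i 0 - y i 0| < 1 by have := xy i 0; rewrite -ball_normE.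
move=> j; rewrite /A /c mxE /= in_itv /= -ler_distlC.
case: (fintype.split j) => i; rewrite mxE; have := Hb i;
  case: (x i 0) (y i 0) => a b [a' b']; rewrite normc_def ltcE /= => /andP[_];
  move=> /ltW; apply: le_trans; rewrite -sqrtr_sqr ler_wsqrtr //.
  by rewrite lerDl sqr_ge0.
by rewrite lerDr sqr_ge0.
Qed.
Definition space_chart (V : normedModType C) : chart V V :=
  @Chart V V setT setT id id openT openT (fun _ _ => I) (fun _ _ => I)
    (fun _ _ => erefl) (fun _ _ => erefl)
    (fun x _ => @cvg_id _ (nbhs x)) (fun x _ => @cvg_id _ (nbhs x)).

Lemma space_atlas_cover (V : normedModType C) (x : V) :
  exists2 c, [set space_chart V] c & chart_dom c x.
Proof. by exists (space_chart V). Qed.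

Lemma space_atlas_compatible (V : normedModType C) (c d : chart V V) :
  [set space_chart V] c -> [set space_chart V] d ->
  forall x, chart_dom c x -> chart_dom d x ->
    differentiable (d \o chart_inv c) (c x).
Proof. by move=> -> -> x _ _ /=; exact: ex_diff. Qed.

Definition Cn_manifold (n : nat) : complexManifold 'cV[C]_n :=
  @ComplexManifold _ 'cV[C]_n [set space_chart _] (@norm_hausdorff _ _)
    (@cV_second_countable n) (@space_atlas_cover _) (@space_atlas_compatible _).

Section Product.
Variables (V W : normedModType C).

Lemma continuousX (S S' T T' : topologicalType) (f : S -> S') (g : T -> T')
    (p : S * T) :
  {for p.1, continuous f} -> {for p.2, continuous g} ->
  {for p, continuous (fun p => (f p.1, g p.2))}.
Proof.
move=> fc gc; apply: cvg_pair => /=.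
  by apply: (@cvg_comp _ _ _ fst f _ (nbhs p.1)); [exact: cvg_fst | exact: fc].
by apply: (@cvg_comp _ _ _ snd g _ (nbhs p.2)); [exact: cvg_snd | exact: gc].
Qed.

Lemma differentiableX (V' W' : normedModType C) (f : V -> V') (g : W -> W')
    (p : V * W) :
  differentiable f p.1 -> differentiable g p.2 ->
  differentiable (fun p => (f p.1, g p.2)) p.
Proof.
move=> df dg; apply: differentiable_pair.
  apply: (differentiable_comp (f := fst)) => //.
  by apply: linear_differentiable => z; exact: cvg_fst.
apply: (differentiable_comp (f := snd)) => //.
by apply: linear_differentiable => z; exact: cvg_snd.
Qed.

Section ProductChart.
Variables (S T : topologicalType) (c : chart S V) (d : chart T W).

Definition prod_chart : chart (S * T)%type (V * W)%type.
Proof.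
refine (@Chart (S * T)%type (V * W)%type
  (chart_dom c `*` chart_dom d) (chart_img c `*` chart_img d)
  (fun p => (c p.1, d p.2)) (fun p => (chart_inv c p.1, chart_inv d p.2))
  (openX (@chart_dom_open _ _ c) (@chart_dom_open _ _ d))
  (openX (@chart_img_open _ _ c) (@chart_img_open _ _ d)) _ _ _ _ _ _).
- by move=> p [? ?]; split; exact: chart_map_img.
- by move=> p [? ?]; split; exact: chart_inv_dom.
- by move=> [x y] [? ?]; rewrite !chart_mapK.
- by move=> [x y] [? ?]; rewrite !chart_invK.
- by move=> p [? ?]; apply: continuousX; exact: chart_map_continuous.
- by move=> p [? ?]; apply: continuousX; exact: chart_inv_continuous.
Defined.

End ProductChart.

Variables (M : complexManifold V) (N : complexManifold W).

Definition prod_atlas : set (chart (M * N)%type (V * W)%type) :=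
  [set e | exists c d, [/\ atlas c, atlas d & e = prod_chart c d]].

Lemma prod_atlas_cover p : exists2 c, prod_atlas c & chart_dom c p.
Proof.
have [c Ac cp] := atlas_cover p.1; have [d Ad dp] := atlas_cover p.2.
by exists (prod_chart c d); [exists c, d | split].
Qed.

Lemma prod_atlas_compatible c d : prod_atlas c -> prod_atlas d ->
  forall p, chart_dom c p -> chart_dom d p ->
    differentiable (d \o chart_inv c) (c p).
Proof.
move=> [c1 [c2 [Ac1 Ac2 ->]]] [d1 [d2 [Ad1 Ad2 ->]]] [x y] [/= cx cy] [/= dx dy].
apply: (@differentiableX _ _ (d1 \o chart_inv c1) (d2 \o chart_inv c2)).
  exact: atlas_compatible.
exact: atlas_compatible.
Qed.

Definition prod_manifold : complexManifold (V * W)%type :=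
  @ComplexManifold _ _ prod_atlas
    (hausdorffX (@manifold_hausdorff _ M) (@manifold_hausdorff _ N))
    (second_countableX (@manifold_second_countable _ M)
                       (@manifold_second_countable _ N))
    prod_atlas_cover prod_atlas_compatible.

End Product.

Section Ellipticity.
Context {V : normedModType C}.

(* Over the open set [U], [phi] is a biholomorphism from the part of [E] above
   [U] onto [U * C^r], with inverse [psi], commuting with the projections and
   linear on each fibre. *)
Definition local_trivialization (M : complexManifold V) (r : nat)
    (E : complexManifold (V * 'cV[C]_r)%type) (proj : E -> M)
    (fibre : M -> lmodType C) (incl : forall x, fibre x -> E) (U : set M)
    (phi : E -> prod_manifold M (Cn_manifold r))
    (psi : prod_manifold M (Cn_manifold r) -> E) : Prop :=
  [/\ holomorphic_on (proj @^-1` U) phi,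
      holomorphic_on (U `*` setT : set (prod_manifold _ _)) psi,
      forall e, U (proj e) -> (phi e).1 = proj e /\ psi (phi e) = e,
      forall p, U p.1 -> proj (psi p) = p.1 /\ phi (psi p) = p
    & forall x, U x ->
        linear (fun v : fibre x => (phi (incl x v)).2 : 'cV[C]_r)].

(* The fibre [E_x] is given as a vector space [bundle_fibre x] together with
   the injection [bundle_incl x] onto the preimage of [x] in the total space;
   its finite-dimensionality follows from local triviality. The rank is constant,
   which is no restriction over a connected base. *)
Record vectorBundle (M : complexManifold V) (r : nat) := VectorBundle {
  bundle_total :> complexManifold (V * 'cV[C]_r)%type;
  bundle_proj : bundle_total -> M;
  bundle_fibre : M -> lmodType C;
  bundle_incl : forall x, bundle_fibre x -> bundle_total;
  bundle_proj_holomorphic : holomorphic bundle_proj;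
  bundle_incl_inj : forall x, injective (@bundle_incl x);
  bundle_incl_range : forall x, range (@bundle_incl x) = bundle_proj @^-1` [set x];
  bundle_locally_trivial : forall x, exists U phi psi,
    [/\ open U, U x & local_trivialization bundle_proj bundle_incl U phi psi]
}.

(* The complex structure of the vector space [E_x] is the one transported from
   [C^r] by a linear isomorphism [L]; it does not depend on [L]. *)
Definition dominating_spray (M : complexManifold V) (r : nat)
    (E : vectorBundle M r) (s : E -> M) : Prop :=
  holomorphic s /\
  forall x : M, s (bundle_incl (0 : bundle_fibre E x)) = x /\
    forall L : {linear 'cV[C]_r -> bundle_fibre E x}, bijective L ->
      submersion_at (fun v : Cn_manifold r => s (bundle_incl (L v)) : M) 0.

Definition elliptic (M : complexManifold V) : Prop :=
  exists r (E : vectorBundle M r) (s : E -> M), dominating_spray s.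

End Ellipticity.

Definition holomorphic_automorphism (V : normedModType C) (f : V -> V) : Prop :=
  entire f /\ exists g, [/\ entire g, cancel f g & cancel g f].

Record autGroup (V : normedModType C) := AutGroup {
  aut_set :> (V -> V) -> Prop;
  aut_holo : forall f, aut_set f -> holomorphic_automorphism f;
  aut_id : aut_set id;
  aut_comp : forall f g, aut_set f -> aut_set g -> aut_set (f \o g);
  aut_inv : forall f g, aut_set f -> cancel f g -> cancel g f -> aut_set g
}.

(* The topology of [Aut V] is the compact-open one. *)
Definition discrete_group (V : normedModType C) (G : autGroup V) : Prop :=
  forall g, G g -> isolated ([set f | G f] : set {compact-open, V -> V}) g.

Definition acts_freely (V : normedModType C) (G : autGroup V) : Prop :=
  forall g, G g -> (exists z, g z = z) -> g = id.

(* Together with freeness this makes the orbit space a Hausdorff manifold. *)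
Definition acts_properly_discontinuously (V : normedModType C) (G : autGroup V)
    : Prop :=
  forall K : set V, compact K ->
    finite_set [set g | G g /\ (g @` K) `&` K !=set0].

Section Orbits.
Variables (V : normedModType C) (G : autGroup V).

Definition same_orbit (x y : V) : bool := `[< exists2 g, G g & g x = y >].

Lemma same_orbit_refl : reflexive same_orbit.
Proof. by move=> x; apply/asboolP; exists id => //; exact: aut_id. Qed.

Lemma same_orbit_sym : symmetric same_orbit.
Proof.
suff H x y : same_orbit x y -> same_orbit y x by move=> x y; apply/idP/idP; exact: H.
move=> /asboolP[g Gg <-]; have [_ [h [_ gK hK]]] := aut_holo Gg.
by apply/asboolP; exists h; [exact: aut_inv Gg gK hK | exact: gK].
Qed.

Lemma same_orbit_trans : transitive same_orbit.
Proof.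
move=> y x z /asboolP[g Gg <-] /asboolP[h Gh <-].
by apply/asboolP; exists (h \o g) => //; exact: aut_comp.
Qed.

Canonical same_orbit_equiv :=
  EquivRel same_orbit same_orbit_refl same_orbit_sym same_orbit_trans.

Definition orbit_space : topologicalType :=
  quotient_topology {eq_quot same_orbit}%qT.

Definition orbit_proj : V -> orbit_space :=
  \pi_(quotient_topology {eq_quot same_orbit})%qT.

Lemma orbit_projP x y : orbit_proj x = orbit_proj y <-> exists2 g, G g & g x = y.
Proof.
by split=> [/eqmodP/asboolP //|h]; apply/eqmodP/asboolP.
Qed.

Lemma orbit_proj_surj p : exists x, orbit_proj x = p.
Proof. by exists (repr p); exact: reprK. Qed.

Lemma orbit_proj_continuous : continuous orbit_proj.
Proof. exact: pi_continuous. Qed.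

Lemma aut_continuous g : G g -> continuous g.
Proof. by move=> Gg z; apply: differentiable_continuous; exact: (aut_holo Gg).1. Qed.

Lemma orbit_proj_open U : open U -> open (orbit_proj @` U).
Proof.
move=> oU; rewrite /open /= /quotient_open.
have -> : orbit_proj @^-1` (orbit_proj @` U) = \bigcup_(g in G) (g @^-1` U).
  apply/seteqP; split=> [y [x Ux /esym/orbit_projP[g Gg gy]]|y [g Gg Ugy]].
    by exists g => //=; rewrite gy.
  by exists (g y) => //; apply/esym/orbit_projP; exists g.
apply: bigcup_open => g Gg; have /continuousP := aut_continuous Gg; exact.
Qed.

Section Charts.
Variables (U : set V) (oU : open U) (injU : set_inj U orbit_proj).

(* The inverse of the projection over an open set [U] on which it is injective;
   these are the charts of the orbit space, so that the projection is locally
   biholomorphic. *)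
Definition orbit_section (p : orbit_space) : V :=
  get [set z | U z /\ orbit_proj z = p].

Lemma orbit_sectionP p : (orbit_proj @` U) p ->
  U (orbit_section p) /\ orbit_proj (orbit_section p) = p.
Proof.
move=> [z Uz zp].
exact: (@getPex _ [set z | U z /\ orbit_proj z = p] (ex_intro _ z (conj Uz zp))).
Qed.

Lemma orbit_sectionK z : U z -> orbit_section (orbit_proj z) = z.
Proof.
move=> Uz; have [|Us sE] := @orbit_sectionP (orbit_proj z); first by exists z.
by apply: injU => //; rewrite inE.
Qed.

Lemma orbit_section_continuous p : (orbit_proj @` U) p ->
  {for p, continuous orbit_section}.
Proof.
move=> [z Uz <-] N; rewrite orbit_sectionK // => /= zN.
have zNU : nbhs z (N° `&` U).
  by apply: filterI; [exact: nbhs_interior | exact: open_nbhs_nbhs].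
have oNU : open (N° `&` U) by apply: openI => //; exact: open_interior.
have : nbhs (orbit_proj z) (orbit_proj @` (N° `&` U)).
  apply: open_nbhs_nbhs; split; first exact: orbit_proj_open.
  by exists z => //; exact: nbhs_singleton zNU.
apply: filterS => _ [w [Nw Uw] <-] /=; rewrite orbit_sectionK //.
exact: interior_subset Nw.
Qed.

Definition orbit_chart : chart orbit_space V := @Chart orbit_space V
  (orbit_proj @` U) U orbit_section orbit_proj (orbit_proj_open oU) oU
  (fun p Up => (orbit_sectionP Up).1) (fun z Uz => imageP _ Uz)
  (fun p Up => (orbit_sectionP Up).2) orbit_sectionK
  orbit_section_continuous (fun z _ => @orbit_proj_continuous z).

End Charts.

Definition orbit_atlas : set (chart orbit_space V) :=
  [set c | exists (U : set V) (oU : open U) (injU : set_inj U orbit_proj),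
     c = orbit_chart oU injU].

Lemma orbit_atlas_compatible c d : orbit_atlas c -> orbit_atlas d ->
  forall p, chart_dom c p -> chart_dom d p ->
    differentiable (d \o chart_inv c) (c p).
Proof.
move=> [U [oU [iU ->]]] [W [oW [iW ->]]] p /= [u Uu <-] /[dup] pW [w Ww].
rewrite orbit_sectionK // => wu.
have /orbit_projP[g Gg gu] := esym wu.
apply: (@near_eq_differentiable _ _ g); last exact: (aut_holo Gg).1.
have : nbhs u (g @^-1` W).
  by apply: aut_continuous => //; rewrite gu; exact: open_nbhs_nbhs.
apply: filterS => z /= Wgz.
rewrite -(orbit_sectionK iW Wgz); congr orbit_section.
by apply/esym/orbit_projP; exists g.
Qed.

Hypothesis Vlc : forall x : V, exists2 K, nbhs x K & compact K.
Hypothesis Gpd : acts_properly_discontinuously G.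

Lemma orbit_separation x y : exists A B, [/\ nbhs x A, nbhs y B &
  forall g, G g -> g x <> y -> forall u, A u -> ~ B (g u)].
Proof.
have [K xK cK] := Vlc x; have [L yL cL] := Vlc y.
have := Gpd (compactU cK cL); set S := [set g | _] => finS.
have sep g : exists AB : set V * set V, [/\ nbhs x AB.1, nbhs y AB.2 &
    G g -> g x <> y -> forall u, AB.1 u -> ~ AB.2 (g u)].
  have [[Gg gxy]|h] := pselect (G g /\ g x <> y); last first.
    exists (setT, setT); split; [exact: filterT|exact: filterT|].
    by move=> Gg gxy; case: h.
  have := @norm_hausdorff _ V; rewrite open_hausdorff => /(_ (g x) y).
  case; first exact/eqP.
  move=> [A B] /= [/set_mem gxA /set_mem yB] [oA oB /eqP AB0].
  exists (g @^-1` A, B); split=> /=.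
  - by apply: aut_continuous => //; exact: open_nbhs_nbhs.
  - exact: open_nbhs_nbhs.
  - move=> _ _ u Au Bu; have : (A `&` B) (g u) by [].
    by rewrite AB0.
have [f fP] := choice sep.
exists (K `&` \bigcap_(g in S) (f g).1).
exists (L `&` \bigcap_(g in S) (f g).2); split.
- by apply: filterI => //; apply: filter_finite_bigcap => // g; case: (fP g).
- by apply: filterI => //; apply: filter_finite_bigcap => // g; case: (fP g).
move=> g Gg gxy u [Ku Au] [Lgu Bgu].
have Sg : S g.
  split=> //; exists (g u); split; last by right.
  by exists u => //; left.
by have [_ _ /(_ Gg gxy u (Au _ Sg))] := fP g; apply; exact: Bgu.
Qed.

Lemma orbit_space_hausdorff : hausdorff_space orbit_space.
Proof.
move=> p q; have [x <-] := orbit_proj_surj p; have [y <-] := orbit_proj_surj q.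
move=> cl; apply: contrapT => xy.
have [A [B [xA yB AB]]] := orbit_separation x y.
have im z D : nbhs z D -> nbhs (orbit_proj z) (orbit_proj @` D).
  move=> zD; have : nbhs (orbit_proj z) (orbit_proj @` D°).
    apply: open_nbhs_nbhs; split; first by apply: orbit_proj_open; exact: open_interior.
    by exists z => //; exact: nbhs_interior.
  by apply: filterS; apply: image_subset; exact: interior_subset.
have [_ [[a Aa <-] [b Bb /esym/orbit_projP[g Gg gab]]]] := cl _ _ (im _ _ xA) (im _ _ yB).
apply: (AB g Gg _ a Aa); last by rewrite gab.
by move=> gxy; apply: xy; apply/orbit_projP; exists g.
Qed.

Lemma orbit_space_second_countable :
  @second_countable V -> @second_countable orbit_space.
Proof.
move=> [B cB [oB bB]]; exists [set orbit_proj @` b | b in B].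
  exact: card_le_trans (card_image_le _ _) cB.
split; first by move=> _ [b Bb <-]; apply: orbit_proj_open; exact: oB.
move=> p N; have [x <-] := orbit_proj_surj p => xN.
have [b [Bb bx] bN] := bB _ _ (orbit_proj_continuous xN).
by exists (orbit_proj @` b); [split; [exists b|exists x]|move=> _ [z /bN Nz <-]].
Qed.

Hypothesis Gfree : acts_freely G.

Lemma orbit_atlas_cover p : exists2 c, orbit_atlas c & chart_dom c p.
Proof.
have [x <-] := orbit_proj_surj p.
have [A [B [xA xB AB]]] := orbit_separation x x.
pose U := (A `&` B)°.
have xU : U x by apply: nbhs_singleton; apply: nbhs_interior; exact: filterI.
have oU : open U by exact: open_interior.
have iU : set_inj U orbit_proj.
  move=> u w /set_mem /interior_subset[Au _] /set_mem /interior_subset[_ Bw].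
  move=> /orbit_projP[g Gg guw].
  have [gx|gx] := pselect (g x = x).
    by rewrite -guw (Gfree Gg) //; exists x.
  by case: (AB g Gg gx u Au); rewrite guw.
by exists (orbit_chart oU iU); [exists U, oU, iU | exists x].
Qed.

Definition quotient_manifold (Vsc : @second_countable V) : complexManifold V :=
  @ComplexManifold V orbit_space orbit_atlas orbit_space_hausdorff
    (orbit_space_second_countable Vsc) orbit_atlas_cover orbit_atlas_compatible.

End Orbits.

Definition affine_automorphism (n : nat) (f : 'cV[C]_n -> 'cV[C]_n) : Prop :=
  exists A b, A \in unitmx /\ forall z, f z = A *m z + b.

Definition Cn_quotient (n : nat) (G : autGroup 'cV[C]_n)
    (Gpd : acts_properly_discontinuously G) (Gfree : acts_freely G) :
    complexManifold 'cV[C]_n :=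
  quotient_manifold (@cV_locally_compact n) Gpd Gfree (@cV_second_countable n).

End ComplexManifolds.

(* Main.v *)
Require Import Defs.
From HB Require Import structures.
From mathcomp Require Import all_boot all_order all_algebra.
From mathcomp Require Import all_classical all_reals all_analysis.

Set Implicit Arguments.
Unset Strict Implicit.
Unset Printing Implicit Defensive.

Import Order.TTheory GRing.Theory Num.Theory.
Import numFieldNormedType.Exports.

Local Open Scope classical_set_scope.
Local Open Scope ring_scope.

(** Write G for the group, M for V / G with V = C^n, and let E be the quotient of
    V * V by the diagonal action g (z, w) = (g z, g w); [p] stands for the class
    of a point p in either quotient.  The maps
    [(z, w)] |-> [z] and [(z, w)] |-> [w] from E to M are well defined; the
    first is the bundle projection and the second is the spray.

    E is the tangent bundle of M in disguise.  In the coordinate v = w - z the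
    action becomes g (z, v) = (g z, g (z + v) - g z), and for affine g, with
    linear part A, this is (g z, A v): the action on the tangent bundle of V.
    The fibres of E are thus vector spaces with transition maps A
    ([triv_map_linear]; this is where affineness enters), and the spray
    is [(z, v)] |-> [z + v].  The coordinate w is preferred because there the
    group law and the descent of the spray to the quotient are immediate.

    The action on V * V inherits freeness and proper discontinuity from the
    action on V ([diag_free], [diag_pd]), so E is a complex manifold.
    Holomorphy of maps out of the quotients is tested after composition with the
    orbit projection ([descent_cdifferentiable]).  Over an open set of M that lifts
    injectively to W in V, a point of E has exactly one representative (z, w)
    with z in W, and (z, w) |-> ([z], w - z) is a trivialization.

    The spray dominates because on the fibre over [z] it is v |-> [z + v], the
    composition of a translation with a local biholomorphism: read in a chart, it
    has a holomorphic local right inverse, and the chain rule makes its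
    differential surjective ([tangent_spray_submersion]). *)

(** * Differentials *)

Lemma near_id_diff (K : numFieldType) (V : normedModType K) (f : V -> V) (x : V) :
  differentiable f x -> (\forall y \near x, f y = y) -> forall v, 'd f x v = v.
Proof.
move=> df fid v.
have did : differentiable (@idfun V) x by exact: ex_diff.
rewrite -deriveE // (near_eq_derive _ fid) (deriveE v did).
by rewrite (@diff_val _ _ _ _ _ _ _ (is_diff_id x)).
Qed.

Lemma right_inverse_diff_surj (K : numFieldType) (V W : normedModType K)
    (h : V -> W) (H : W -> V) (w : W) :
  differentiable h (H w) -> differentiable H w ->
  (\forall u \near w, h (H u) = u) -> forall u, exists v, 'd h (H w) v = u.
Proof.
move=> dh dH near_id u; exists ('d H w u).
have E : 'd (h \o H) w u = u.
  by apply: near_id_diff => //; exact: differentiable_comp.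
by rewrite -[RHS]E (diff_comp dH dh).
Qed.

(** Over an arbitrary numeric field linear maps from a finite-dimensional space
    are still continuous, being combinations of the coordinates. *)
Lemma linear_cV_differentiable (K : numFieldType) (m : nat) (W : normedModType K)
    (L : {linear 'cV[K]_m -> W}) (v : 'cV[K]_m) : differentiable L v.
Proof.
have -> : (L : 'cV[K]_m -> W) =
    \sum_(i < m) (fun v : 'cV[K]_m => v i 0 *: L (delta_mx i 0)).
  apply/funext => u; rewrite fct_sumE {1}[u]matrix_sum_delta linear_sum.
  by apply: eq_bigr => i _; rewrite big_ord1 linearZ.
apply: differentiable_sum => i.
by apply: differentiableZl; exact: differentiable_coord.
Qed.

Lemma near_eq_continuous (S T : topologicalType) (f g : S -> T) (x : S) :
  (\forall y \near x, f y = g y) -> {for x, continuous f} -> {for x, continuous g}.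
Proof.
move=> fg fc; rewrite /prop_for /continuous_at -(nbhs_singleton fg).
exact: cvg_trans (near_eq_cvg fg) fc.
Qed.

Lemma continuous_for_pair (S T U : topologicalType) (f : S -> T) (g : S -> U) (x : S) :
  {for x, continuous f} -> {for x, continuous g} ->
  {for x, continuous (fun y => (f y, g y))}.
Proof. by move=> fc gc; exact: cvg_pair. Qed.

Lemma differentiable_fst (K : numFieldType) (V W : normedModType K) (p : V * W) :
  differentiable (fst : V * W -> V) p.
Proof. by apply: linear_differentiable => z; exact: cvg_fst. Qed.

Lemma differentiable_snd (K : numFieldType) (V W : normedModType K) (p : V * W) :
  differentiable (snd : V * W -> W) p.
Proof. by apply: linear_differentiable => z; exact: cvg_snd. Qed.

(** * Maps out of an orbit space *)

Section OrbitSpaceMaps.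
Variables (R : realType) (V : normedModType (Cplx R)) (G : autGroup V).

(** A chart undoes the projection up to a group element, so the composition
    agrees near z with that element, which is entire. *)
Lemma orbit_chart_proj_differentiable d z :
  @orbit_atlas _ _ G d -> chart_dom d (orbit_proj G z) ->
  differentiable (d \o orbit_proj G) z.
Proof.
move=> [W [oW [iW ->]]] /= [w Ww] /esym/orbit_projP[g Gg gz].
apply: (@near_eq_differentiable _ _ _ g); last exact: (aut_holo Gg).1.
have : nbhs z (g @^-1` W).
  by apply: (aut_continuous Gg); rewrite gz; exact: open_nbhs_nbhs.
apply: filterS => y /= Wgy; rewrite -(orbit_sectionK iW Wgy).
by congr orbit_section; apply/esym/orbit_projP; exists g.
Qed.

Variables (Vlc : forall x : V, exists2 K, nbhs x K & compact K)
  (Gpd : acts_properly_discontinuously G) (Gfree : acts_freely G)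
  (Vsc : @second_countable V).

Lemma orbit_proj_nbhs z D : nbhs z D -> nbhs (orbit_proj G z) (orbit_proj G @` D).
Proof.
move=> zD; have : nbhs (orbit_proj G z) (orbit_proj G @` D°).
  apply: open_nbhs_nbhs; split; first by apply: orbit_proj_open; exact: open_interior.
  by exists z => //; exact: nbhs_interior.
by apply: filterS; apply: image_subset; exact: interior_subset.
Qed.

Lemma descent_continuous (T : topologicalType) (f : orbit_space G -> T) z :
  {for z, continuous (f \o orbit_proj G)} -> {for orbit_proj G z, continuous f}.
Proof.
move=> fc N /fc /orbit_proj_nbhs; apply: filterS => _ [y Ny <-]; exact: Ny.
Qed.

(** Charts centred at different points of the orbit of z read f through
    representatives g z, while the hypothesis concerns z only; invariance of
    f composed with the projection under g moves the differentiability over. *)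
Lemma descent_cdifferentiable (W : normedModType (Cplx R)) (N : complexManifold W)
    (f : quotient_manifold Vlc Gpd Gfree Vsc -> N) z :
  {for z, continuous (f \o orbit_proj G)} ->
  (forall d, atlas d -> chart_dom d (f (orbit_proj G z)) ->
     differentiable (d \o f \o orbit_proj G) z) ->
  cdifferentiable_at f (orbit_proj G z).
Proof.
move=> fc fd; split; first exact: (@descent_continuous N f).
move=> c d [U [oU [iU ->]]] Ad /= [u Uu uz] dz.
rewrite -uz orbit_sectionK //.
have /orbit_projP[g Gg gu] := uz.
have -> : d \o f \o orbit_proj G = (d \o f \o orbit_proj G) \o g.
  apply/funext => y /=; congr (d (f _)).
  by apply/orbit_projP; exists g.
apply: differentiable_comp; first exact: (aut_holo Gg).1.
by rewrite gu; exact: fd.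
Qed.

End OrbitSpaceMaps.

(** * The diagonal action *)

Section DiagonalAction.
Variables (R : realType) (V : normedModType (Cplx R)) (G : autGroup V).

Definition diag_map (g : V -> V) (p : V * V) : V * V := (g p.1, g p.2).

Definition diag_set (f : V * V -> V * V) : Prop := exists2 g, G g & f = diag_map g.

Lemma diag_holo f : diag_set f -> holomorphic_automorphism f.
Proof.
move=> [g Gg ->]; have [dg [h [dh gK hK]]] := aut_holo Gg; split.
  by move=> p; apply: (@Defs.differentiableX _ _ _ _ _ g g).
exists (diag_map h); split.
- by move=> p; apply: (@Defs.differentiableX _ _ _ _ _ h h).
- by move=> [x y]; rewrite /diag_map /= !gK.
- by move=> [x y]; rewrite /diag_map /= !hK.
Qed.

Lemma diag_id : diag_set id.
Proof. by exists id; [exact: aut_id | apply/funext => -[]]. Qed.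

Lemma diag_comp f g : diag_set f -> diag_set g -> diag_set (f \o g).
Proof.
by move=> [f' Gf ->] [g' Gg ->]; exists (f' \o g') => //; exact: aut_comp.
Qed.

Lemma diag_inv f g : diag_set f -> cancel f g -> cancel g f -> diag_set g.
Proof.
move=> [f' Gf ->] fK gK; have [_ [h [_ f'K hK]]] := aut_holo Gf.
exists h; first exact: aut_inv Gf f'K hK.
apply/funext => -[x y]; rewrite -[RHS]fK; congr g.
by rewrite /diag_map /= !hK.
Qed.

Definition diagGroup : autGroup (V * V)%type :=
  AutGroup diag_holo diag_id diag_comp diag_inv.

Lemma diag_free : acts_freely G -> acts_freely diagGroup.
Proof.
move=> Gf _ [g Gg ->] [[x y] [gx _]].
by rewrite (Gf g Gg) //; [apply/funext => -[] | exists x].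
Qed.

(** If the diagonal map of g moves K to a set that meets K, then g does the same
    with the first projection of K, which is compact. *)
Lemma diag_pd :
  acts_properly_discontinuously G -> acts_properly_discontinuously diagGroup.
Proof.
move=> Gpd K cK.
have cK1 : compact (fst @` K).
  by apply: continuous_compact => //; apply: continuous_subspaceT => p; exact: cvg_fst.
apply: sub_finite_set (finite_image diag_map (Gpd _ cK1)).
move=> _ [[g Gg ->] [_ [[[x y] Kxy <-] Kg]]]; exists g => //; split=> //.
exists (g x); split; first by exists x => //; exists (x, y).
by exists (diag_map g (x, y)).
Qed.

Lemma diag_projP (x y x' y' : V) :
  orbit_proj diagGroup (x, y) = orbit_proj diagGroup (x', y') <->
  exists g, [/\ G g, g x = x' & g y = y'].
Proof.
split=> [/orbit_projP[_ [g Gg ->] [<- <-]]|[g [Gg <- <-]]]; first by exists g.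
by apply/orbit_projP; exists (diag_map g) => //; exists g.
Qed.

(** The projections of V * V are equivariant, so the choice of representative is
    immaterial, both here and in [diag_snd]. *)
Definition diag_fst (e : orbit_space diagGroup) : orbit_space G :=
  orbit_proj G (repr e).1.

Definition diag_snd (e : orbit_space diagGroup) : orbit_space G :=
  orbit_proj G (repr e).2.

Lemma repr_orbit_proj (W : normedModType (Cplx R)) (H : autGroup W)
   (e : orbit_space H) : orbit_proj H (repr e) = e.
Proof. exact: reprK. Qed.

Lemma diag_fstE p : diag_fst (orbit_proj diagGroup p) = orbit_proj G p.1.
Proof.
have := repr_orbit_proj (orbit_proj diagGroup p).
rewrite /diag_fst; move: (repr _ : V * V) => q.
case: q p => [x y] [x' y'] /diag_projP[g [Gg gx _]].
by apply/orbit_projP; exists g.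
Qed.

Lemma diag_sndE p : diag_snd (orbit_proj diagGroup p) = orbit_proj G p.2.
Proof.
have := repr_orbit_proj (orbit_proj diagGroup p).
rewrite /diag_snd; move: (repr _ : V * V) => q.
case: q p => [x y] [x' y'] /diag_projP[g [Gg _ gy]].
by apply/orbit_projP; exists g.
Qed.

End DiagonalAction.

Lemma locally_compactX (S T : topologicalType) :
  (forall x : S, exists2 K, nbhs x K & compact K) ->
  (forall y : T, exists2 K, nbhs y K & compact K) ->
  forall p : S * T, exists2 K, nbhs p K & compact K.
Proof.
move=> Slc Tlc [x y]; have [K xK cK] := Slc x; have [L yL cL] := Tlc y.
by exists (K `*` L); [exists (K, L) | exact: compact_setX].
Qed.

(** * The tangent bundle of the quotient *)

Section TangentBundle.
Variables (R : realType) (n : nat).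
Local Notation C := (Cplx R).
Local Notation V := ('cV[C]_n).
Variables (G : autGroup V)
  (G_affine : forall g, G g -> affine_automorphism g)
  (Gfree : acts_freely G) (Gpd : acts_properly_discontinuously G).

Local Notation M := (Cn_quotient Gpd Gfree).
Local Notation piG := (orbit_proj G).
Local Notation piD := (orbit_proj (diagGroup G)).

Definition tangent_total : complexManifold (V * V)%type :=
  quotient_manifold
    (locally_compactX (@cV_locally_compact R n) (@cV_locally_compact R n))
    (diag_pd Gpd) (diag_free Gfree)
    (second_countableX (@cV_second_countable R n) (@cV_second_countable R n)).

Local Notation E := tangent_total.

Definition tangent_proj : E -> M := @diag_fst R V G.
Definition tangent_spray : E -> M := @diag_snd R V G.

Lemma orbit_proj_lift (e : E) : exists p, piD p = e.
Proof. exact: orbit_proj_surj. Qed.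

Lemma tangent_proj_holomorphic : holomorphic tangent_proj.
Proof.
move=> e _; have [p <-] := orbit_proj_lift e.
have E1 : tangent_proj \o piD = piG \o fst by apply/funext => q; exact: diag_fstE.
apply: descent_cdifferentiable.
  rewrite E1; apply: continuous_comp; first exact: cvg_fst.
  exact: orbit_proj_continuous.
move=> d Ad; rewrite /tangent_proj diag_fstE => dp.
rewrite -compA E1 compA.
apply: differentiable_comp; first exact: differentiable_fst.
exact: orbit_chart_proj_differentiable.
Qed.

Lemma tangent_spray_holomorphic : holomorphic tangent_spray.
Proof.
move=> e _; have [p <-] := orbit_proj_lift e.
have E2 : tangent_spray \o piD = piG \o snd by apply/funext => q; exact: diag_sndE.
apply: descent_cdifferentiable.
  rewrite E2; apply: continuous_comp; first exact: cvg_snd.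
  exact: orbit_proj_continuous.
move=> d Ad; rewrite /tangent_spray diag_sndE => dp.
rewrite -compA E2 compA.
apply: differentiable_comp; first exact: differentiable_snd.
exact: orbit_chart_proj_differentiable.
Qed.

(** The representative of x in V identifies the fibre over x with C^n.  The
    identification depends on this choice, which need not vary continuously with
    x; only the linear structure matters, and it is the same for every choice
    because group elements are affine. *)
Definition tangent_incl (x : M) (v : V) : E :=
  piD ((repr x : V), (repr x : V) + v).

Lemma repr_proj (x : M) : piG (repr x) = x.
Proof. exact: reprK. Qed.

(** Two vectors with the same image differ by a group element fixing the
    representative of x, hence trivial. *)
Lemma tangent_incl_inj x : injective (tangent_incl x).
Proof.
move=> v w /diag_projP[g [Gg gx]].
rewrite (Gfree Gg) => [/addrI //|]; by exists (repr x).
Qed.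

Lemma tangent_incl_range x : range (tangent_incl x) = tangent_proj @^-1` [set x].
Proof.
apply/seteqP; split=> [_ [v _ <-]|e] /=.
  by rewrite /tangent_incl /tangent_proj diag_fstE repr_proj.
have [[z w] <-] := orbit_proj_lift e.
rewrite /tangent_proj diag_fstE -{1}[x]repr_proj => /orbit_projP[g Gg gz].
exists (g w - repr x) => //; rewrite /tangent_incl addrC subrK.
by apply/esym/diag_projP; exists g.
Qed.

Section Trivialization.
Variables (W : set V) (oW : open W) (iW : set_inj W piG).

Lemma strip_open : open (W `*` [set: V]).
Proof. exact: openX oW openT. Qed.

(** Injectivity over W forces the element relating two representatives to fix
    a point of W, so freeness makes the second components agree as well. *)
Lemma strip_inj : set_inj (W `*` [set: V]) piD.
Proof.
move=> [z w] [z' w'] /set_mem[/= Wz _] /set_mem[/= Wz' _] /diag_projP[g [Gg gz gw]].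
have zz' : z = z' by apply: iW; rewrite ?inE //; apply/orbit_projP; exists g.
by rewrite -gw zz' (Gfree Gg) //; exists z; rewrite gz.
Qed.

Local Notation sigma := (@orbit_section R V G W).
Local Notation tau := (@orbit_section R (V * V)%type (diagGroup G) (W `*` [set: V])).

(** The second component passes from w back to the tangent vector w - z. *)
Definition triv_map (e : E) : prod_manifold M (Cn_manifold R n) :=
  (tangent_proj e, (tau e).2 - (tau e).1).

Definition triv_inv (p : prod_manifold M (Cn_manifold R n)) : E :=
  piD (sigma p.1, sigma p.1 + p.2).

Lemma strip_lift (e : E) : (piG @` W) (tangent_proj e) ->
  exists z w, W z /\ piD (z, w) = e.
Proof.
have [[z w] <-] := orbit_proj_lift e.
rewrite /tangent_proj diag_fstE => -[z' Wz' /esym/orbit_projP[g Gg gz]].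
by exists z', (g w); split=> //; apply/esym/diag_projP; exists g.
Qed.

Lemma tauE z w : W z -> tau (piD (z, w)) = (z, w).
Proof. by move=> Wz; apply: (orbit_sectionK strip_inj). Qed.

Lemma triv_mapE z w : W z -> triv_map (piD (z, w)) = (piG z, w - z).
Proof. by move=> Wz; rewrite /triv_map tauE // /tangent_proj diag_fstE. Qed.

Lemma triv_mapK e : (piG @` W) (tangent_proj e) ->
  (triv_map e).1 = tangent_proj e /\ triv_inv (triv_map e) = e.
Proof.
move=> /strip_lift[z [w [Wz <-]]]; split=> //.
by rewrite triv_mapE // /triv_inv /= (orbit_sectionK iW Wz) addrC subrK.
Qed.

Lemma triv_invK p : (piG @` W) p.1 ->
  tangent_proj (triv_inv p) = p.1 /\ triv_map (triv_inv p) = p.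
Proof.
case: p => [_ v] /= [z Wz <-]; rewrite /triv_inv /= (orbit_sectionK iW Wz).
by rewrite triv_mapE // /tangent_proj diag_fstE /= addrAC subrr add0r.
Qed.

(** If g maps the chosen representative of x to the one in W, the fibre
    coordinate changes from v to g (repr x + v) - g (repr x), which is A v for g
    affine with linear part A. *)
Lemma triv_map_linear x : (piG @` W) x ->
  linear (fun v : V => (triv_map (tangent_incl x v)).2 : V).
Proof.
move=> [z Wz zx].
have /orbit_projP[g Gg gx] : piG (repr x) = piG z by rewrite repr_proj.
have [A [b [_ gE]]] := G_affine Gg.
have fE v : (triv_map (tangent_incl x v)).2 = A *m v.
  have -> : tangent_incl x v = piD (z, g (repr x + v)).
    by apply/diag_projP; exists g.
  by rewrite triv_mapE //= -gx !gE mulmxDr [_ + _ + b]addrAC [LHS]addrC addKr.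
by move=> a u v; rewrite !fE linearP.
Qed.

Lemma triv_map_holomorphic :
  holomorphic_on (tangent_proj @^-1` (piG @` W)) triv_map.
Proof.
move=> _ /strip_lift[z [w [Wz <-]]].
have nearE : \forall p \near ((z, w) : V * V),
    (piG p.1, p.2 - p.1) = triv_map (piD p).
  have : nbhs (z, w) (W `*` [set: V]).
    by apply: open_nbhs_nbhs; split=> //; exact: strip_open.
  by apply: filterS => -[z' w'] [/= Wz' _]; rewrite triv_mapE.
have dB : differentiable (fun p : V * V => p.2 - p.1) (z, w).
  by apply: differentiableB; [exact: differentiable_snd|exact: differentiable_fst].
apply: descent_cdifferentiable.
  apply: near_eq_continuous nearE _.
  apply: (@continuous_for_pair _ M V (piG \o fst));
    last exact: differentiable_continuous.
  apply: continuous_comp; first exact: cvg_fst.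
  exact: orbit_proj_continuous.
move=> _ [c [d [Ac -> ->]]]; rewrite triv_mapE // => -[/= cz _].
apply: (@near_eq_differentiable _ _ _ (fun p => (c (piG p.1), p.2 - p.1))).
  by apply: filterS nearE => p /(congr1 (prod_chart c (space_chart V))).
apply: differentiable_pair => //.
apply: (differentiable_comp (f := fst) (g := c \o piG)); first exact: differentiable_fst.
exact: orbit_chart_proj_differentiable.
Qed.

Lemma triv_inv_holomorphic :
  holomorphic_on ((piG @` W : set M) `*` [set: Cn_manifold R n] :
    set (prod_manifold M (Cn_manifold R n))) triv_inv.
Proof.
move=> [x v] [/= Wx _]; split.
  have sc : {for (x, v), continuous (fun p : M * V => sigma p.1)}.
    apply: continuous_comp; first exact: cvg_fst.
    exact: orbit_section_continuous.
  have vc : {for (x, v), continuous (snd : M * V -> V)} by exact: cvg_snd.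
  have pc := continuous_for_pair sc (cvgD sc vc).
  apply: (@continuous_comp (M * V)%type (V * V)%type E
    (fun p => (sigma p.1, sigma p.1 + p.2)) piD (x, v)); first exact: pc.
  exact: orbit_proj_continuous.
move=> _ d [c [_ [Ac -> ->]]] Ad [/= cx _] dx.
have ds : differentiable (fun p : V * V => sigma (chart_inv c p.1)) (c x, v).
  apply: (differentiable_comp (f := fst) (g := sigma \o chart_inv c)).
    exact: differentiable_fst.
  apply: (@atlas_compatible _ _ M c (orbit_chart oW iW)) => //.
  by exists W, oW, iW.
have dp : differentiable (fun p : V * V =>
    (sigma (chart_inv c p.1), sigma (chart_inv c p.1) + p.2)) (c x, v).
  exact: differentiable_pair ds (differentiableD ds (differentiable_snd _)).
apply: (differentiable_comp dp (g := d \o piD)).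
apply: orbit_chart_proj_differentiable => //=.
by rewrite chart_mapK.
Qed.

End Trivialization.

Lemma tangent_locally_trivial x : exists U phi psi,
  [/\ open U, U x & local_trivialization tangent_proj tangent_incl U phi psi].
Proof.
have [_ [W [oW [iW ->]]] Wx] := atlas_cover x.
exists (piG @` W), (@triv_map W), (@triv_inv W); split=> //.
  exact: orbit_proj_open.
split.
- exact: triv_map_holomorphic.
- exact: triv_inv_holomorphic.
- exact: triv_mapK.
- exact: triv_invK.
- exact: triv_map_linear.
Qed.

Definition tangent_bundle : vectorBundle M n :=
  @VectorBundle _ _ M n E tangent_proj (fun=> V) tangent_incl
    tangent_proj_holomorphic tangent_incl_inj tangent_incl_range
    tangent_locally_trivial.

(** Let k in G map the value u0 of the chart at x to the representative of x.
    Then H u = L^-1 (k u - repr x) inverts the spray on the right near u0: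
    it leads from u to the class of k u, which is the class of u. *)
Lemma tangent_spray_submersion x (L : {linear V -> V}) : bijective L ->
  submersion_at (fun v : Cn_manifold R n => tangent_spray (tangent_incl x (L v)) : M) 0.
Proof.
move=> [L' LK L'K].
have L'lin : linear L' by move=> a u v; apply: (can_inj LK); rewrite linearP !L'K.
pose L'L : {linear V -> V} := HB.pack L' (GRing.isLinear.Build _ _ _ _ _ L'lin).
have sE : (fun v : V => tangent_spray (tangent_incl x (L v))) =
    piG \o (fun v : V => (repr x : V) + L v).
  by apply/funext => v; rewrite /tangent_incl /tangent_spray diag_sndE.
have dL v : differentiable (fun v : V => (repr x : V) + L v) v.
  apply: differentiableD; first exact: differentiable_cst.
  exact: linear_cV_differentiable.
have dh d v : @orbit_atlas _ _ G d -> chart_dom d (piG ((repr x : V) + L v)) ->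
    differentiable (d \o (piG \o (fun v : V => (repr x : V) + L v))) v.
  move=> Ad dv; apply: (differentiable_comp (dL v) (g := d \o piG)).
  exact: orbit_chart_proj_differentiable.
rewrite sE; split; first split.
- apply: continuous_comp; first exact: (differentiable_continuous (dL _)).
  exact: orbit_proj_continuous.
- by move=> _ d -> Ad _; exact: dh.
move=> _ d -> Ad _ d0; have := dh d 0 Ad d0; case: Ad d0 => [U [oU [iU ->]]] U0.
rewrite [_ \o _ \o _]/(_ \o _) /=.
set u0 := orbit_section U (piG ((repr x : V) + L 0)).
have [Uu0 u0E] : U u0 /\ piG u0 = piG (repr x : V).
  have [Uu0 u0E] := orbit_sectionP U0; split=> //.
  by apply: etrans u0E _; rewrite /= linear0 addr0.
have /orbit_projP[k Gk ku0] := u0E.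
have dH : differentiable (fun u => L'L (k u - (repr x : V))) u0.
  apply: (differentiable_comp (f := fun u => k u - (repr x : V)) (g := L'L)).
    apply: differentiableB; last exact: differentiable_cst.
    exact: (aut_holo Gk).1.
  exact: linear_cV_differentiable.
have H0 : L'L (k u0 - (repr x : V)) = 0 by rewrite ku0 subrr linear0.
pose h v := orbit_section U (piG ((repr x : V) + L v)).
pose H u := L'L (k u - (repr x : V)).
move=> dh0.
have hH : \forall u \near u0, h (H u) = u.
  have : nbhs u0 U by exact: open_nbhs_nbhs.
  apply: filterS => u Uu; rewrite /h /H L'K addrC subrK.
  rewrite -[RHS](orbit_sectionK iU Uu); congr orbit_section.
  by apply/esym/orbit_projP; exists k.
have dhH : differentiable h (H u0) by rewrite /H H0.
have := right_inverse_diff_surj dhH dH hH.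
by rewrite /H H0.
Qed.

Lemma tangent_spray_dominating :
  @dominating_spray _ _ M n tangent_bundle tangent_spray.
Proof.
split; first exact: tangent_spray_holomorphic.
move=> x; split; last exact: tangent_spray_submersion.
by rewrite /= /tangent_incl /tangent_spray diag_sndE /= addr0 repr_proj.
Qed.

End TangentBundle.

Theorem theorem1 (R : realType) (n : nat) (Gamma : autGroup 'cV[Cplx R]_n)
    (Gamma_discrete : discrete_group Gamma)
    (Gamma_affine : forall g, Gamma g -> affine_automorphism g)
    (Gamma_free : acts_freely Gamma)
    (Gamma_pd : acts_properly_discontinuously Gamma) :
  elliptic (Cn_quotient Gamma_pd Gamma_free).
Proof.
exists n, (tangent_bundle Gamma_affine Gamma_free Gamma_pd).
exists (@tangent_spray R n Gamma Gamma_free Gamma_pd).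
exact: tangent_spray_dominating.
Qed.
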